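(* Let $\mathcal{K},\mathcal{L}$ be tensor triangulated categories, each equipped with a dimension function, let $n\in\mathbb{Z}$, and let $F:\mathcal{K}\to\mathcal{L}$ be an exact functor of relative dimension $\le n$. Then $F$ induces group homomorphisms $$\mathrm{z}^n_p(F):\mathrm{Z}^{\Delta}_p(\mathcal{K})\to\mathrm{Z}^{\Delta}_{p+n}(\mathcal{L})\qquad\text{and}\qquad \mathrm{c}^n_p(F):\mathrm{CH}^{\Delta}_p(\mathcal{K})\to\mathrm{CH}^{\Delta}_{p+n}(\mathcal{L})$$ for all $p\in\mathbb{Z}$. If $F$ has relative dimension $<n$, then $\mathrm{z}^n_p(F)$ and $\mathrm{c}^n_p(F)$ are both trivial (zero).
   Context: A tensor triangulated category $\mathcal{K}$ is an essentially small triangulated category with a symmetric monoidal structure $(\otimes,\mathbb{I})$ such that $\otimes$ is exact in each variable. A prime ideal of $\mathcal{K}$ is a proper thick triangulated subcategory $\mathcal{P}$ with $\mathcal{K}\otimes\mathcal{P}\subset\mathcal{P}$ such that $A\otimes B\in\mathcal{P}$ implies $A\in\mathcal{P}$ or $B\in\mathcal{P}$. $\operatorname{Spc}(\mathcal{K})$ is the set of prime ideals, topologized by the basis of closed sets $\operatorname{supp}(A)=\{\mathcal{P}: A\notin\mathcal{P}\}$, $A\in\mathcal{K}$. A dimension function on $\mathcal{K}$ is a map $\dim:\operatorname{Spc}(\mathcal{K})\to\mathbb{Z}\cup\{\pm\infty\}$ such that $\mathcal{Q}\subset\mathcal{P}$ implies $\dim\mathcal{Q}\le\dim\mathcal{P}$,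 and $\mathcal{Q}\subset\mathcal{P}$ with $\dim\mathcal{Q}=\dim\mathcal{P}\in\mathbb{Z}$ implies $\mathcal{Q}=\mathcal{P}$. For $V\subset\operatorname{Spc}(\mathcal{K})$, $\dim(V)=\sup_{\mathcal{P}\in V}\dim(\mathcal{P})$ (so $\dim\emptyset=-\infty$), and $\mathcal{K}_{(p)}\subset\mathcal{K}$ is the full subcategory of objects $a$ with $\dim(\operatorname{supp}(a))\le p$ (a thick tensor ideal). Write $(-)^{\natural}$ for idempotent completion and $\mathrm{K}_0$ for the Grothendieck group of a triangulated category. The $p$-dimensional cycle group is $\mathrm{Z}^{\Delta}_p(\mathcal{K}):=\mathrm{K}_0\big((\mathcal{K}_{(p)}/\mathcal{K}_{(p-1)})^{\natural}\big)$ (Verdier quotient). Let $i:\mathrm{K}_0(\mathcal{K}_{(p)})\to\mathrm{K}_0(\mathcal{K}_{(p+1)})$, $q:\mathrm{K}_0(\mathcal{K}_{(p)})\to\mathrm{K}_0(\mathcal{K}_{(p)}/\mathcal{K}_{(p-1)})$ and $j:\mathrm{K}_0(\mathcal{K}_{(p)}/\mathcal{K}_{(p-1)})\to\mathrm{Z}^{\Delta}_p(\mathcal{K})$ be induced by the inclusion, the Verdier quotient functor and the embedding into the idempotent completion. The $p$-dimensional Chow group is $\mathrm{CH}^{\Delta}_p(\mathcal{K}):=\mathrm{Z}^{\Delta}_p(\mathcal{K})/(j\circ q)(\ker i)$. An exact functor $F:\mathcal{K}\to\mathcal{L}$ (not necessarily a tensor functor) has relative dimension $n\in\mathbb{Z}$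 if $F(\mathcal{K}_{(p)})\subset\mathcal{L}_{(p+n)}$ for all $p$ and $n$ is the smallest integer with this property. It has relative dimension $\le n$ (resp. $<n$) if it has relative dimension $m$ for some $m\le n$ (resp. $m<n$). ''Induces'' means: $F$ restricts to $\mathcal{K}_{(p)}\to\mathcal{L}_{(p+n)}$ and so gives an exact functor $\mathcal{K}_{(p)}/\mathcal{K}_{(p-1)}\to\mathcal{L}_{(p+n)}/\mathcal{L}_{(p+n-1)}$, hence a functor $\hat F$ of the idempotent completions; $\mathrm{z}^n_p(F)=\mathrm{K}_0(\hat F)$, and $\mathrm{c}^n_p(F)$ is the homomorphism on quotient groups induced by $\mathrm{z}^n_p(F)$. *)

(* Defs.v *)
From HB Require Import structures.
From mathcomp Require Import all_boot all_order all_algebra.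
From mathcomp Require Import generic_quotient ring_quotient.
From mathcomp Require Import boolp classical_sets constructive_ereal.
From mathcomp.multinomials Require Import freeg.

Set Implicit Arguments.
Unset Strict Implicit.
Unset Printing Implicit Defensive.

Import Order.TTheory GRing.Theory Num.Theory.
Local Open Scope ring_scope.

(* Objects and morphisms form types, so every category is small, hence
   essentially small, relative to a larger universe. *)
Record category := Category {
  obj :> Type;
  hom : obj -> obj -> Type;
  idm : forall A, hom A A;
  comp : forall A B C, hom B C -> hom A B -> hom A C;
  compA : forall A B C D (h : hom C D) (g : hom B C) (f : hom A B),
    comp h (comp g f) = comp (comp h g) f;
  comp1m : forall A B (f : hom A B), comp (idm B) f = f;
  compm1 : forall A B (f : hom A B), comp f (idm A) = f }.
Arguments idm {c} A.
Arguments comp {c A B C} _ _.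

Notation "g ∘ f" := (comp g f) (at level 40, left associativity).

Definition is_iso (C : category) (A B : C) (f : hom A B) : Prop :=
  exists g : hom B A, g ∘ f = idm A /\ f ∘ g = idm B.

Definition isomorphic (C : category) (A B : C) : Prop :=
  exists f : hom A B, is_iso f.

Definition is_zero (C : category) (Z : C) : Prop :=
  forall A, (exists! f : hom Z A, True) /\ (exists! f : hom A Z, True).

Record functor (C D : category) := Functor {
  fobj :> C -> D;
  fmap : forall A B : C, hom A B -> hom (fobj A) (fobj B);
  fmap1 : forall A : C, fmap (idm A) = idm (fobj A);
  fmapM : forall (A B C' : C) (g : hom B C') (f : hom A B),
    fmap (g ∘ f) = fmap g ∘ fmap f }.
Arguments fmap {C D} _ {A B} _.

Definition id_functor (C : category) : functor C C :=
  @Functor C C (fun A => A) (fun A B f => f)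
    (fun _ => erefl) (fun _ _ _ _ _ => erefl).

Definition comp_functor (C D E : category) (G : functor D E) (F : functor C D) :
  functor C E.
Proof.
exists (fun A => G (F A)) (fun A B f => fmap G (fmap F f)).
- by move=> A; rewrite !fmap1.
- by move=> A B C' g f; rewrite !fmapM.
Defined.

Lemma is_iso_idm (C : category) (A : C) : is_iso (idm A).
Proof. by exists (idm A); rewrite comp1m. Qed.

Lemma is_iso_comp (C : category) (A B D : C) (g : hom B D) (f : hom A B) :
  is_iso g -> is_iso f -> is_iso (g ∘ f).
Proof.
case=> g' [g1 g2] [f' [f1 f2]]; exists (f' ∘ g'); split.
- by rewrite compA -(compA f') g1 compm1.
- by rewrite compA -(compA g) f2 compm1.
Qed.

Lemma is_iso_fmap (C D : category) (F : functor C D) (A B : C) (f : hom A B) :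
  is_iso f -> is_iso (fmap F f).
Proof. by case=> g [h1 h2]; exists (fmap F g); rewrite -!fmapM h1 h2 !fmap1. Qed.

Record shift_category := ShiftCategory {
  sc_category :> category;
  shift : functor sc_category sc_category }.
Arguments shift {s}.

Notation Σ := shift.

Record triangle (T : shift_category) := Triangle {
  t1 : T; t2 : T; t3 : T;
  tf : hom t1 t2;
  tg : hom t2 t3;
  th : hom t3 (Σ t1) }.
Arguments Triangle {T t1 t2 t3} _ _ _.

Record triangle_mor (T : shift_category) (t u : triangle T) := TriangleMor {
  m1 : hom (t1 t) (t1 u);
  m2 : hom (t2 t) (t2 u);
  m3 : hom (t3 t) (t3 u);
  m_f : m2 ∘ tf t = tf u ∘ m1;
  m_g : m3 ∘ tg t = tg u ∘ m2;
  m_h : fmap Σ m1 ∘ th t = th u ∘ m3 }.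

Definition triangle_iso (T : shift_category) (t u : triangle T) : Prop :=
  exists m : triangle_mor t u, [/\ is_iso (m1 m), is_iso (m2 m) & is_iso (m3 m)].

(* A shift category with a class of distinguished triangles: the data, without
   any axiom, on which exact functors and Grothendieck groups depend. *)
Record tri_data := TriData {
  td_shift :> shift_category;
  dist : triangle td_shift -> Prop }.

Definition map_triangle (T U : shift_category) (F : functor T U)
    (phi : forall A : T, hom (F (Σ A)) (Σ (F A))) (t : triangle T) : triangle U :=
  Triangle (fmap F (tf t)) (fmap F (tg t)) (phi (t1 t) ∘ fmap F (th t)).

Record exact_functor (T U : tri_data) := ExactFunctor {
  ef_functor :> functor T U;
  ef_shift : forall A : T, hom (ef_functor (Σ A)) (Σ (ef_functor A));
  ef_shift_iso : forall A : T, is_iso (ef_shift A);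
  ef_shift_nat : forall (A B : T) (f : hom A B),
    ef_shift B ∘ fmap ef_functor (fmap Σ f) =
    fmap Σ (fmap ef_functor f) ∘ ef_shift A;
  ef_dist : forall t : triangle T, dist t -> dist (map_triangle ef_shift t) }.

Definition exact_iso (T U : tri_data) (F G : exact_functor T U) : Prop :=
  exists eta : forall A : T, hom (F A) (G A),
  [/\ forall A, is_iso (eta A),
      forall (A B : T) (f : hom A B), eta B ∘ fmap F f = fmap G f ∘ eta A &
      forall A, fmap Σ (eta A) ∘ ef_shift F A = ef_shift G A ∘ eta (Σ A)].

Definition id_exact (T : tri_data) : exact_functor T T.
Proof.
exists (id_functor T) (fun A => idm (Σ A)).
- by move=> A; apply: is_iso_idm.
- by move=> A B f /=; rewrite comp1m compm1.
- by case=> X Y Z f g h; rewrite /map_triangle /= comp1m.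
Defined.

Definition comp_exact (T U V : tri_data) (G : exact_functor U V)
  (F : exact_functor T U) : exact_functor T V.
Proof.
exists (comp_functor G F) (fun A => ef_shift G (F A) ∘ fmap G (ef_shift F A)).
- move=> A; apply: is_iso_comp; first exact: ef_shift_iso.
  exact/is_iso_fmap/ef_shift_iso.
- move=> A B f /=.
  by rewrite -compA -fmapM ef_shift_nat fmapM compA ef_shift_nat compA.
- move=> t /(@ef_dist _ _ F) /(@ef_dist _ _ G).
  by rewrite /map_triangle /= fmapM compA.
Defined.

Record preadditive_tri_data := PreadditiveTriData {
  ptd_data :> tri_data;
  hom_zmod : forall A B : ptd_data, GRing.Zmodule (hom A B) }.

HB.instance Definition _ (T : preadditive_tri_data) (A B : T) :
  GRing.Zmodule (hom A B) := hom_zmod A B.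

Definition is_biproduct (T : preadditive_tri_data) (A B C : T) : Prop :=
  exists (i1 : hom A C) (i2 : hom B C) (p1 : hom C A) (p2 : hom C B),
  [/\ p1 ∘ i1 = idm A, p2 ∘ i2 = idm B, p2 ∘ i1 = 0, p1 ∘ i2 = 0 &
      i1 ∘ p1 + i2 ∘ p2 = idm C].

Record triangulated_axioms (T : preadditive_tri_data) : Prop := {
  tr_compDl : forall (A B C : T) (g g' : hom B C) (f : hom A B),
    (g + g') ∘ f = g ∘ f + g' ∘ f;
  tr_compDr : forall (A B C : T) (g : hom B C) (f f' : hom A B),
    g ∘ (f + f') = g ∘ f + g ∘ f';
  tr_zero : exists Z : T, is_zero Z;
  tr_biproduct : forall A B : T, exists C, is_biproduct A B C;
  tr_shiftD : forall (A B : T) (f g : hom A B),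
    fmap Σ (f + g) = fmap Σ f + fmap Σ g;
  tr_shift_inj : forall (A B : T) (f g : hom A B), fmap Σ f = fmap Σ g -> f = g;
  tr_shift_full : forall (A B : T) (g : hom (Σ A) (Σ B)),
    exists f : hom A B, fmap Σ f = g;
  tr_shift_surj : forall B : T, exists A : T, isomorphic (Σ A) B;
  tr_iso : forall t u : triangle T, triangle_iso t u -> dist t -> dist u;
  tr_id : forall A Z : T, is_zero Z ->
    dist (Triangle (idm A) (0 : hom A Z) (0 : hom Z (Σ A)));
  tr_cone : forall (A B : T) (f : hom A B),
    exists (C : T) (g : hom B C) (h : hom C (Σ A)), dist (Triangle f g h);
  tr_rotate : forall (A B C : T) (f : hom A B) (g : hom B C) (h : hom C (Σ A)),
    dist (Triangle f g h) <-> dist (Triangle g h (- fmap Σ f));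
  tr_complete : forall (t u : triangle T)
      (a : hom (t1 t) (t1 u)) (b : hom (t2 t) (t2 u)),
    dist t -> dist u -> b ∘ tf t = tf u ∘ a ->
    exists m : triangle_mor t u, m1 m = a /\ m2 m = b;
  tr_octahedral : forall (X Y Z U V W : T) (f : hom X Y) (g : hom Y Z)
      (i : hom Y U) (i' : hom U (Σ X)) (j : hom Z W) (j' : hom W (Σ Y))
      (k : hom Z V) (k' : hom V (Σ X)),
    dist (Triangle f i i') -> dist (Triangle g j j') ->
    dist (Triangle (g ∘ f) k k') ->
    exists (u : hom U V) (v : hom V W),
      dist (Triangle u v (fmap Σ i ∘ j')) /\
      [/\ u ∘ i = k ∘ g, k' ∘ u = i', v ∘ k = j & j' ∘ v = fmap Σ f ∘ k'] }.

Record triangulated := Triangulated {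
  tr_data :> preadditive_tri_data;
  tr_axioms : triangulated_axioms tr_data }.

Definition is_additive (T U : preadditive_tri_data) (F : functor T U) : Prop :=
  forall (A B : T) (f g : hom A B), fmap F (f + g) = fmap F f + fmap F g.

Section TriangulatedLemmas.
Variable T : triangulated.
Let ax := tr_axioms T.

Lemma comp0m (A B C : T) (f : hom A B) : (0 : hom B C) ∘ f = 0.
Proof.
have /eqP := tr_compDl ax (0 : hom B C) 0 f.
by rewrite addr0 -subr_eq0 opprD addrA subrr add0r oppr_eq0 => /eqP.
Qed.

Lemma compm0 (A B C : T) (g : hom B C) : g ∘ (0 : hom A B) = 0.
Proof.
have /eqP := tr_compDr ax g (0 : hom A B) 0.
by rewrite addr0 -subr_eq0 opprD addrA subrr add0r oppr_eq0 => /eqP.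
Qed.

Lemma compNm (A B C : T) (g : hom B C) (f : hom A B) : (- g) ∘ f = - (g ∘ f).
Proof. by apply/eqP; rewrite -addr_eq0 -(tr_compDl ax) addNr comp0m. Qed.

Lemma compmN (A B C : T) (g : hom B C) (f : hom A B) : g ∘ (- f) = - (g ∘ f).
Proof. by apply/eqP; rewrite -addr_eq0 -(tr_compDr ax) addNr compm0. Qed.

Lemma fmap_shiftN (A B : T) (f : hom A B) : fmap Σ (- f) = - fmap Σ f.
Proof.
have E0 : fmap Σ (0 : hom A B) = 0.
  have /eqP := tr_shiftD ax (0 : hom A B) 0.
  by rewrite addr0 -subr_eq0 opprD addrA subrr add0r oppr_eq0 => /eqP.
by apply/eqP; rewrite -addr_eq0 -(tr_shiftD ax) addNr E0.
Qed.

Lemma is_zeroP (Z : T) : is_zero Z <-> idm Z = 0.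
Proof.
split=> [/(_ Z) [[f [_ uf]] _]|Z0 A]; first by rewrite -(uf (idm Z)) // (uf 0).
split; exists 0; split=> // f _.
- by rewrite -[f]compm1 Z0 compm0.
- by rewrite -[f]comp1m Z0 comp0m.
Qed.

Lemma dist_shift (A B C : T) (f : hom A B) (g : hom B C) (h : hom C (Σ A)) :
  dist (Triangle f g h) -> dist (Triangle (fmap Σ f) (fmap Σ g) (- fmap Σ h)).
Proof.
move=> /(tr_rotate ax) /(tr_rotate ax) /(tr_rotate ax); apply: (tr_iso ax).
have nn (X : T) : (- idm X) ∘ (- idm X) = idm X.
  by rewrite compNm compmN comp1m opprK.
unshelve eexists.
  apply: (@TriangleMor _ (Triangle _ _ _) (Triangle _ _ _)
           (idm (Σ A)) (- idm (Σ B)) (idm (Σ C))) => /=.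
  - by rewrite compNm compmN opprK comp1m compm1.
  - by rewrite comp1m compmN compm1.
  - by rewrite fmap1 comp1m compm1.
split=> /=; try exact: is_iso_idm.
by exists (- idm (Σ B)); rewrite nn.
Qed.

End TriangulatedLemmas.

Record is_thick (T : triangulated) (J : T -> Prop) : Prop := {
  thick_zero : forall Z, is_zero Z -> J Z;
  thick_iso : forall A B, isomorphic A B -> J A -> J B;
  thick_shift : forall A, J A <-> J (Σ A);
  thick_cone : forall t : triangle T, dist t -> J (t1 t) -> J (t2 t) -> J (t3 t);
  thick_biproduct : forall A B C, is_biproduct A B C -> J A -> J B -> J C;
  thick_summand : forall A B C, is_biproduct A B C -> J C -> J A }.

(* Thick triangulated subcategories are full and closed under isomorphisms, so
   they are given by predicates on objects. *)
Record thick (T : triangulated) := Thick {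
  in_thick :> T -> Prop;
  thickP : is_thick in_thick }.

Section FullSubcategory.
Variables (T : triangulated) (J : thick T).

Definition full_category : category :=
  @Category {A : T | J A} (fun A B => hom (sval A) (sval B))
    (fun A => idm (sval A)) (fun A B C g f => g ∘ f)
    (fun _ _ _ _ h g f => compA h g f)
    (fun _ _ f => comp1m f) (fun _ _ f => compm1 f).

Definition full_shift_functor : functor full_category full_category :=
  @Functor full_category full_category
    (fun A => exist J (Σ (sval A)) ((thick_shift (thickP J) (sval A)).1 (svalP A)))
    (fun A B f => fmap Σ (f : hom (sval A) (sval B)))
    (fun A => fmap1 Σ (sval A))
    (fun _ _ _ g f => fmapM Σ (g : hom (sval _) (sval _)) f).

Definition full_shift := ShiftCategory full_shift_functor.

Definition full_triangle (t : triangle full_shift) : triangle T :=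
  @Triangle T (sval (t1 t)) (sval (t2 t)) (sval (t3 t)) (tf t) (tg t) (th t).

Definition full_data : preadditive_tri_data :=
  @PreadditiveTriData
    (@TriData full_shift (fun t => dist (full_triangle t)))
    (fun A B => hom_zmod (sval A) (sval B)).

Lemma full_isomorphic (A B : full_data) :
  isomorphic (sval A) (sval B) -> isomorphic A B.
Proof. by case=> f [g fg]; exists f, g. Qed.

Lemma full_zero (Z : full_data) : is_zero Z <-> is_zero (sval Z).
Proof.
split=> [/(_ Z) [[f [_ uf]] _]|Z0 A]; last exact: Z0 (sval A).
apply/is_zeroP; rewrite -[LHS](uf (idm Z : hom Z Z)) //.
exact: (uf (0 : hom (sval Z) (sval Z))).
Qed.

Lemma full_axioms : triangulated_axioms full_data.
Proof.
have ax := tr_axioms T; have th := thickP J.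
split.
- by move=> A B C g g' f; apply: (tr_compDl ax).
- by move=> A B C g f f'; apply: (tr_compDr ax).
- have [Z Z0] := tr_zero ax.
  by exists (exist _ Z (thick_zero th Z0)); apply/full_zero.
- move=> A B; have [C biC] := tr_biproduct ax (sval A) (sval B).
  by exists (exist _ C (thick_biproduct th biC (svalP A) (svalP B))).
- by move=> A B f g; apply: (tr_shiftD ax).
- by move=> A B f g; apply: (tr_shift_inj ax).
- by move=> A B g; apply: (tr_shift_full ax).
- move=> B; have [A isoA] := tr_shift_surj ax (sval B).
  have JA : J A.
    apply/(thick_shift th)/(thick_iso th _ (svalP B)).
    by case: isoA => f [g [fg gf]]; exists g, f.
  by exists (exist _ A JA); apply: full_isomorphic.
- move=> t u [m [i1 i2 i3]]; apply: (tr_iso ax).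
  by exists (@TriangleMor T (full_triangle t) (full_triangle u)
    (m1 m) (m2 m) (m3 m) (m_f m) (m_g m) (m_h m)).
- by move=> A Z /full_zero Z0; apply: (tr_id ax).
- move=> A B f; have [C [g [h d]]] := tr_cone ax (f : hom (sval A) (sval B)).
  have JC : J C by apply: (thick_cone th d); apply: svalP.
  by exists (exist _ C JC), g, h.
- by move=> A B C f g h; apply: (tr_rotate ax).
- move=> t u a b dt du ab.
  have [m [ma mb]] :=
    @tr_complete _ ax (full_triangle t) (full_triangle u) a b dt du ab.
  by exists (@TriangleMor full_data t u
    (m1 m) (m2 m) (m3 m) (m_f m) (m_g m) (m_h m)).
- move=> X Y Z U V W f g i i' j j' k k'.
  exact: (@tr_octahedral _ ax (sval X) (sval Y) (sval Z) (sval U) (sval V) (sval W)).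
Qed.

Definition full_subcategory : triangulated := Triangulated full_axioms.

End FullSubcategory.

Definition restrict (T U : triangulated) (F : exact_functor T U)
  (J : thick T) (I : thick U) (FJI : forall A : T, J A -> I (F A)) :
  exact_functor (full_subcategory J) (full_subcategory I).
Proof.
unshelve eexists.
- unshelve eexists.
  + by move=> A; exists (F (sval A)); apply: FJI (svalP A).
  + by move=> A B f; apply: (fmap F (f : hom (sval A) (sval B))).
  + by move=> A; apply: (fmap1 F).
  + by move=> A B C g f; apply: (fmapM F).
- by move=> A; apply: (ef_shift F (sval A)).
- by move=> A; apply: (ef_shift_iso F (sval A)).
- by move=> A B f; apply: (ef_shift_nat F).
- by move=> t; apply: (@ef_dist _ _ F (full_triangle t)).
Defined.

Lemma is_thick_within (T : triangulated) (J I : thick T) :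
  @is_thick (full_subcategory J) (fun A => I (sval A)).
Proof.
have th := thickP I; split.
- by move=> Z /full_zero; apply: (thick_zero th).
- by move=> A B [f [g fg]]; apply: (thick_iso th); exists f, g.
- by move=> A; apply: (thick_shift th).
- by move=> t; apply: (@thick_cone _ _ th (full_triangle t)).
- by move=> A B C; apply: (@thick_biproduct _ _ th (sval A) (sval B) (sval C)).
- by move=> A B C; apply: (@thick_summand _ _ th (sval A) (sval B) (sval C)).
Qed.

Definition thick_within (T : triangulated) (J I : thick T) :
  thick (full_subcategory J) := Thick (is_thick_within J I).

Section Localization.
Variables (C : category) (S : forall A B : C, hom A B -> Prop).

(* Words in the morphisms of [C] and formal inverses of those in [S]. *)
Inductive word : C -> C -> Type :=
| w_of A B of hom A B : word A B
| w_inv A B (s : hom A B) of S s : word B A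
| w_comp A B D of word B D & word A B : word A D.

Inductive weq : forall A B, word A B -> word A B -> Prop :=
| weq_refl A B (x : word A B) : weq x x
| weq_sym A B (x y : word A B) : weq x y -> weq y x
| weq_trans A B (x y z : word A B) : weq x y -> weq y z -> weq x z
| weq_comp A B D (x x' : word B D) (y y' : word A B) :
    weq x x' -> weq y y' -> weq (w_comp x y) (w_comp x' y')
| weq_compA A B D E (x : word D E) (y : word B D) (z : word A B) :
    weq (w_comp x (w_comp y z)) (w_comp (w_comp x y) z)
| weq_comp1m A B (x : word A B) : weq (w_comp (w_of (idm B)) x) x
| weq_compm1 A B (x : word A B) : weq (w_comp x (w_of (idm A))) x
| weq_of A B D (g : hom B D) (f : hom A B) :
    weq (w_of (g ∘ f)) (w_comp (w_of g) (w_of f))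
| weq_invl A B (s : hom A B) (Ss : S s) :
    weq (w_comp (w_inv Ss) (w_of s)) (w_of (idm A))
| weq_invr A B (s : hom A B) (Ss : S s) :
    weq (w_comp (w_of s) (w_inv Ss)) (w_of (idm B)).

HB.instance Definition _ A B := gen_eqMixin (word A B).
HB.instance Definition _ A B := gen_choiceMixin (word A B).

Definition weqb A B (x y : word A B) : bool := `[< weq x y >].

Lemma weqb_equiv A B : equiv_class_of (@weqb A B).
Proof.
split=> [x|x y|y x z]; rewrite /weqb.
- exact/asboolP/weq_refl.
- by apply/asboolP/asboolP; apply: weq_sym.
- by move=> /asboolP xy /asboolP yz; apply/asboolP; apply: weq_trans yz.
Qed.

Canonical weqb_equiv_rel A B := EquivRelPack (@weqb_equiv A B).

Definition loc_hom A B := {eq_quot (@weqb A B)}%qT.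

Definition loc_cl A B (x : word A B) : loc_hom A B := \pi_(loc_hom A B)%qT x.

Lemma loc_clP A B (x y : word A B) : loc_cl x = loc_cl y <-> weq x y.
Proof.
split=> [/eqmodP /asboolP //|xy]; exact/eqmodP/asboolP.
Qed.

Lemma loc_clK A B (f : loc_hom A B) : loc_cl (repr f) = f.
Proof. exact: reprK. Qed.

Definition loc_comp A B D (g : loc_hom B D) (f : loc_hom A B) : loc_hom A D :=
  loc_cl (w_comp (repr g) (repr f)).

Lemma loc_compE A B D (y : word B D) (x : word A B) :
  loc_comp (loc_cl y) (loc_cl x) = loc_cl (w_comp y x).
Proof. by apply/loc_clP/weq_comp; apply/loc_clP; rewrite loc_clK. Qed.

Definition localization : category.
Proof.
exists C loc_hom (fun A => loc_cl (w_of (idm A))) loc_comp.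
- move=> A B D E h g f; rewrite -[h]loc_clK -[g]loc_clK -[f]loc_clK !loc_compE.
  exact/loc_clP/weq_compA.
- move=> A B f; rewrite -[f]loc_clK loc_compE; exact/loc_clP/weq_comp1m.
- move=> A B f; rewrite -[f]loc_clK loc_compE; exact/loc_clP/weq_compm1.
Defined.

Definition loc_functor : functor C localization.
Proof.
refine (@Functor C localization (fun A => A) (fun A B f => loc_cl (w_of f)) _ _).
  by [].
by move=> A B D g f /=; rewrite loc_compE; apply/loc_clP/weq_of.
Defined.

End Localization.

Section LocalizationMap.
Variables (C D : category) (S : forall A B : C, hom A B -> Prop).
Variables (S' : forall A B : D, hom A B -> Prop) (F : functor C D).
Hypothesis FS : forall (A B : C) (f : hom A B), S f -> S' (fmap F f).

Fixpoint word_map A B (x : word S A B) : word S' (F A) (F B) :=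
  match x with
  | w_of _ _ f => w_of S' (fmap F f)
  | w_inv _ _ _ Ss => w_inv (FS Ss)
  | w_comp _ _ _ y z => w_comp (word_map y) (word_map z)
  end.

Lemma weq_map A B (x y : word S A B) : weq x y -> weq (word_map x) (word_map y).
Proof.
elim=> {A B x y} /=.
- by move=> *; apply: weq_refl.
- by move=> *; apply: weq_sym.
- by move=> A B x y z _ xy _ yz; apply: weq_trans yz.
- by move=> *; apply: weq_comp.
- by move=> *; apply: weq_compA.
- by move=> A B x; rewrite fmap1; apply: weq_comp1m.
- by move=> A B x; rewrite fmap1; apply: weq_compm1.
- by move=> A B E g f; rewrite fmapM; apply: weq_of.
- by move=> A B s Ss; rewrite fmap1; apply: weq_invl.
- by move=> A B s Ss; rewrite fmap1; apply: weq_invr.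
Qed.

Definition loc_map : functor (localization S) (localization S').
Proof.
refine (@Functor (localization S) (localization S') F
  (fun A B (f : loc_hom S A B) => loc_cl (word_map (repr f))) _ _).
- move=> A; have /loc_clP/weq_map/loc_clP := loc_clK (loc_cl (w_of S (idm (A : C)))).
  by rewrite /= fmap1.
- move=> A B E g f.
  have /loc_clP/weq_map/loc_clP := loc_clK (loc_cl (w_comp (repr g) (repr f))).
  by rewrite /= loc_compE.
Defined.

Lemma loc_mapE A B (x : word S A B) :
  fmap loc_map (loc_cl x : hom (_ : localization S) _) = loc_cl (word_map x).
Proof. by apply/loc_clP/weq_map; apply/loc_clP; rewrite loc_clK. Qed.

End LocalizationMap.

Section VerdierQuotient.
Variables (T : triangulated) (J : thick T).

Definition verdier_inverted (A B : T) (f : hom A B) : Prop :=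
  exists (C : T) (g : hom B C) (h : hom C (Σ A)), dist (Triangle f g h) /\ J C.

Lemma verdier_inverted_shift (A B : T) (f : hom A B) :
  verdier_inverted f -> verdier_inverted (fmap Σ f).
Proof.
move=> [C [g [h [d JC]]]]; exists (Σ C), (fmap Σ g), (- fmap Σ h).
by split; [apply: dist_shift|exact: (thick_shift (thickP J) C).1].
Qed.

Definition verdier_shift : shift_category :=
  ShiftCategory (loc_map verdier_inverted_shift).

Definition verdier_functor : functor T verdier_shift :=
  loc_functor verdier_inverted.

Definition verdier_image (t : triangle T) : triangle verdier_shift :=
  @map_triangle T verdier_shift verdier_functor
    (fun A => idm (Σ A : verdier_shift)) t.

(* The Verdier quotient is the localization at the morphisms whose cone lies in
   [J]; its distinguished triangles are those isomorphic to the image of a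
   distinguished triangle.  The additive structure of its morphism sets is
   determined by the category and is not recorded. *)
Definition verdier : tri_data :=
  @TriData verdier_shift
    (fun u => exists t : triangle T, dist t /\ triangle_iso (verdier_image t) u).

Definition verdier_quotient : exact_functor T verdier.
Proof.
refine (@ExactFunctor T verdier verdier_functor
  (fun A => idm (Σ A : verdier)) _ _ _).
- by move=> A; apply: is_iso_idm.
- move=> A B f; rewrite comp1m compm1; apply: esym.
  exact: (loc_mapE verdier_inverted_shift (w_of _ f)).
- move=> t dt; exists t; split=> //.
  unshelve eexists.
    by exists (idm _) (idm _) (idm _); rewrite ?fmap1 comp1m compm1.
  by split; apply: is_iso_idm.
Defined.

End VerdierQuotient.

Section Karoubi.
Variable T : tri_data.

Record karoubi_obj := KaroubiObj {
  k_obj : T;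
  k_idem : hom k_obj k_obj;
  k_idemK : k_idem ∘ k_idem = k_idem }.

Definition karoubi_hom (A B : karoubi_obj) :=
  {f : hom (k_obj A) (k_obj B) | f ∘ k_idem A = f /\ k_idem B ∘ f = f}.

Lemma karoubi_hom_eq (A B : karoubi_obj) (f g : karoubi_hom A B) :
  sval f = sval g -> f = g.
Proof. by case: f g => [f hf] [g hg] /= fg; apply: eq_exist. Qed.

Definition karoubi_id (A : karoubi_obj) : karoubi_hom A A :=
  exist _ (k_idem A) (conj (k_idemK A) (k_idemK A)).

Definition karoubi_comp (A B C : karoubi_obj)
  (g : karoubi_hom B C) (f : karoubi_hom A B) : karoubi_hom A C.
Proof.
exists (sval g ∘ sval f); split.
- by rewrite -compA (svalP f).1.
- by rewrite compA (svalP g).2.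
Defined.

Definition karoubi_category : category.
Proof.
exists karoubi_obj karoubi_hom karoubi_id karoubi_comp.
- by move=> A B C D h g f; apply: karoubi_hom_eq; apply: compA.
- by move=> A B f; apply: karoubi_hom_eq; apply: (svalP f).2.
- by move=> A B f; apply: karoubi_hom_eq; apply: (svalP f).1.
Defined.

Definition karoubi_shift_obj (A : karoubi_obj) : karoubi_obj.
Proof.
by exists (Σ (k_obj A)) (fmap Σ (k_idem A)); rewrite -fmapM k_idemK.
Defined.

Definition karoubi_shift_functor : functor karoubi_category karoubi_category.
Proof.
unshelve refine (@Functor karoubi_category karoubi_category karoubi_shift_obj _ _ _).
- move=> A B f; exists (fmap Σ (sval f)).
  by rewrite /= -!fmapM (svalP f).1 (svalP f).2.
- by move=> A; apply: karoubi_hom_eq.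
- by move=> A B C g f; apply: karoubi_hom_eq; apply: fmapM.
Defined.

Definition karoubi_shift : shift_category := ShiftCategory karoubi_shift_functor.

Definition karoubi_embed_obj (A : T) : karoubi_obj := KaroubiObj (comp1m (idm A)).

Definition karoubi_functor : functor T karoubi_shift.
Proof.
unshelve refine (@Functor T karoubi_shift karoubi_embed_obj _ _ _).
- by move=> A B f; exists f; rewrite /= comp1m compm1.
- by move=> A; apply: karoubi_hom_eq.
- by move=> A B C g f; apply: karoubi_hom_eq.
Defined.

(* The idempotents on the two sides are [idm (Σ A)] and [fmap Σ (idm A)]. *)
Definition karoubi_functor_shift (A : T) :
  hom (karoubi_functor (Σ A)) (Σ (karoubi_functor A)).
Proof. by exists (idm (Σ A)); rewrite /= fmap1 comp1m. Defined.

Definition karoubi_image (t : triangle T) : triangle karoubi_shift :=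
  map_triangle karoubi_functor_shift t.

(* Following Balmer and Schlichting, the distinguished triangles of the
   idempotent completion are the direct factors of images of distinguished
   triangles. *)
Definition karoubi : tri_data :=
  @TriData karoubi_shift (fun u => exists t : triangle T, dist t /\
    exists (s : triangle_mor u (karoubi_image t))
           (r : triangle_mor (karoubi_image t) u),
    [/\ m1 r ∘ m1 s = idm (t1 u), m2 r ∘ m2 s = idm (t2 u) &
        m3 r ∘ m3 s = idm (t3 u)]).

Definition karoubi_embedding : exact_functor T karoubi.
Proof.
refine (@ExactFunctor T karoubi karoubi_functor karoubi_functor_shift _ _ _).
- move=> A; unshelve eexists.
    by exists (idm (Σ A)); rewrite /= fmap1 comp1m.
  by split; apply: karoubi_hom_eq; rewrite /= comp1m ?fmap1.
- by move=> A B f; apply: karoubi_hom_eq; rewrite /= comp1m compm1.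
- move=> t dt; exists t; split=> //.
  unshelve eexists.
    by exists (idm _) (idm _) (idm _); rewrite ?fmap1 comp1m compm1.
  unshelve eexists.
    by exists (idm _) (idm _) (idm _); rewrite ?fmap1 comp1m compm1.
  by split; apply: comp1m.
Defined.

End Karoubi.

Section KaroubiMap.
Variables (T U : tri_data) (F : exact_functor T U).

Definition karoubi_map_obj (A : karoubi_obj T) : karoubi_obj U.
Proof. by exists (F (k_obj A)) (fmap F (k_idem A)); rewrite -fmapM k_idemK. Defined.

Definition karoubi_map_functor : functor (karoubi T) (karoubi U).
Proof.
unshelve refine (@Functor (karoubi T) (karoubi U) karoubi_map_obj _ _ _).
- move=> A B f; exists (fmap F (sval f)).
  by rewrite /= -!fmapM (svalP f).1 (svalP f).2.
- by move=> A; apply: karoubi_hom_eq.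
- by move=> A B C g f; apply: karoubi_hom_eq; apply: fmapM.
Defined.

Definition karoubi_map_shift (A : karoubi T) :
  hom (karoubi_map_functor (Σ A)) (Σ (karoubi_map_functor A)).
Proof.
exists (ef_shift F (k_obj A) ∘ fmap F (fmap Σ (k_idem A))); split=> /=.
- by rewrite -compA -!fmapM k_idemK.
- by rewrite ef_shift_nat compA -!fmapM k_idemK.
Defined.

Definition karoubi_map_mor (t : triangle T) (u : triangle (karoubi T)) :
  triangle_mor u (karoubi_image t) ->
  triangle_mor (map_triangle karoubi_map_shift u)
               (karoubi_image (map_triangle (ef_shift F) t)).
Proof.
move=> m; unshelve eapply TriangleMor.
- by exists (fmap F (sval (m1 m))); split=> /=;
    rewrite ?comp1m // -fmapM (svalP (m1 m)).1.
- by exists (fmap F (sval (m2 m))); split=> /=;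
    rewrite ?comp1m // -fmapM (svalP (m2 m)).1.
- by exists (fmap F (sval (m3 m))); split=> /=;
    rewrite ?comp1m // -fmapM (svalP (m3 m)).1.
- apply: karoubi_hom_eq => /=.
  by have /(congr1 sval) /= := m_f m; rewrite -!fmapM => ->.
- apply: karoubi_hom_eq => /=.
  by have /(congr1 sval) /= := m_g m; rewrite -!fmapM => ->.
- apply: karoubi_hom_eq => /=; rewrite comp1m.
  have /(congr1 sval) /= := m_h m; rewrite comp1m => e.
  rewrite -[RHS]compA -(fmapM F (th t)) -e fmapM !compA ef_shift_nat.
  rewrite -!compA -!fmapM; congr (_ ∘ (_ ∘ fmap F _)).
  exact: (svalP (th u)).2.
Defined.

Definition karoubi_map_mor' (t : triangle T) (u : triangle (karoubi T)) :
  triangle_mor (karoubi_image t) u ->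
  triangle_mor (karoubi_image (map_triangle (ef_shift F) t))
               (map_triangle karoubi_map_shift u).
Proof.
move=> m; unshelve eapply TriangleMor.
- by exists (fmap F (sval (m1 m))); split=> /=;
    rewrite ?compm1 // -fmapM (svalP (m1 m)).2.
- by exists (fmap F (sval (m2 m))); split=> /=;
    rewrite ?compm1 // -fmapM (svalP (m2 m)).2.
- by exists (fmap F (sval (m3 m))); split=> /=;
    rewrite ?compm1 // -fmapM (svalP (m3 m)).2.
- apply: karoubi_hom_eq => /=.
  by have /(congr1 sval) /= := m_f m; rewrite -!fmapM => ->.
- apply: karoubi_hom_eq => /=.
  by have /(congr1 sval) /= := m_g m; rewrite -!fmapM => ->.
- apply: karoubi_hom_eq => /=; rewrite comp1m.
  have /(congr1 sval) /= := m_h m; rewrite comp1m => e.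
  rewrite compA -ef_shift_nat -compA -fmapM e fmapM compA.
  rewrite -!compA -!fmapM; congr (_ ∘ fmap F _).
  by rewrite !compA (svalP (th u)).2.
Defined.

Definition karoubi_map : exact_functor (karoubi T) (karoubi U).
Proof.
refine (@ExactFunctor _ _ karoubi_map_functor karoubi_map_shift _ _ _).
- move=> A; have [g [gf fg]] := ef_shift_iso F (k_obj A).
  have gnat : fmap F (fmap Σ (k_idem A)) ∘ g = g ∘ fmap Σ (fmap F (k_idem A)).
    rewrite -[LHS]comp1m -gf -!compA; congr (_ ∘ _).
    by rewrite compA ef_shift_nat -compA fg compm1.
  unshelve eexists.
    exists (fmap F (fmap Σ (k_idem A)) ∘ g); split=> /=.
    + by rewrite gnat -compA -fmapM -fmapM k_idemK.
    + by rewrite compA -!fmapM k_idemK.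
  split; apply: karoubi_hom_eq => /=.
  + by rewrite compA -(compA _ g) gf compm1 -!fmapM k_idemK.
  + rewrite -(compA (ef_shift F (k_obj A))) (compA _ _ g) -!fmapM k_idemK.
    by rewrite gnat compA fg comp1m.
- move=> A B f; apply: karoubi_hom_eq => /=.
  rewrite -compA -!fmapM (svalP f).2 compA -ef_shift_nat -compA -!fmapM.
  by rewrite (svalP f).1.
- move=> u [t [dt [s [r [e1 e2 e3]]]]].
  exists (map_triangle (ef_shift F) t); split; first exact: ef_dist.
  exists (karoubi_map_mor s), (karoubi_map_mor' r).
  move: e1 e2 e3 => /(congr1 sval) /= e1 /(congr1 sval) /= e2 /(congr1 sval) /= e3.
  by split; apply: karoubi_hom_eq; rewrite /= -fmapM ?e1 ?e2 ?e3.
Defined.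

End KaroubiMap.

Definition quotient_group (G : zmodType) (H : zmodClosed G) : zmodType :=
  Quotient.quot H.

Definition quotient_map (G : zmodType) (H : zmodClosed G) :
  {additive G -> quotient_group H} := \pi_(Quotient.quot H)%qT.

Lemma quotient_mapK (G : zmodType) (H : zmodClosed G) (x : quotient_group H) :
  quotient_map H (repr (x : Quotient.quot H)) = x.
Proof. exact: reprK. Qed.

Lemma quotient_map_eq (G : zmodType) (H : zmodClosed G) (x y : G) :
  quotient_map H x = quotient_map H y <-> x - y \in H.
Proof. by rewrite Quotient.idealrBE; split=> [/eqP|/eqP]. Qed.

Section Grothendieck.
Variable T : tri_data.

(* The subgroup generated by the elements [Y] - [X] - [Z], for distinguished
   triangles X -> Y -> Z -> ΣX.  Isomorphic objects get equal classes because of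
   the triangles A -> B -> 0 -> ΣA. *)
Inductive K0_relation : {freeg {classic T}} -> Prop :=
| K0_relation0 : K0_relation 0
| K0_relationB x y : K0_relation x -> K0_relation y -> K0_relation (x - y)
| K0_relation_dist (t : triangle T) : dist t ->
    K0_relation (<< (t2 t : {classic T}) >> - << (t1 t : {classic T}) >>
                 - << (t3 t : {classic T}) >>).

Definition K0_relations : {pred {freeg {classic T}}} := fun x => `[< K0_relation x >].

Lemma K0_relations_closed : zmod_closed K0_relations.
Proof.
split=> [|x y /asboolP Rx /asboolP Ry]; apply/asboolP; first exact: K0_relation0.
exact: K0_relationB.
Qed.

HB.instance Definition _ := GRing.isZmodClosed.Build {freeg {classic T}}
  K0_relations K0_relations_closed.

Definition K0 : zmodType := quotient_group K0_relations.

Definition K0_class (A : T) : K0 :=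
  quotient_map K0_relations << (A : {classic T}) >>.

Section Lift.
Variables (M : zmodType) (f : T -> M).
Hypothesis f_dist : forall t : triangle T, dist t ->
  f (t2 t) = f (t1 t) + f (t3 t).

Definition K0_lift_freeg (x : {freeg {classic T}}) : M :=
  fglift (f : {classic T} -> zmodule M) x.

Definition K0_lift_fun (x : K0) : M := K0_lift_freeg (repr (x : Quotient.quot K0_relations)).

Lemma K0_lift_freegB x y :
  K0_lift_freeg (x - y) = K0_lift_freeg x - K0_lift_freeg y.
Proof. exact: (@lift_is_additive int {classic T} (zmodule M) f). Qed.

Lemma K0_lift_freegU (A : T) : K0_lift_freeg << (A : {classic T}) >> = f A.
Proof. by rewrite /K0_lift_freeg liftU scale1r. Qed.

Lemma K0_lift_freeg_rel x : K0_relation x -> K0_lift_freeg x = 0.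
Proof.
elim=> [|y z _ y0 _ z0|t dt].
- by rewrite -[X in K0_lift_freeg X](subrr 0) K0_lift_freegB subrr.
- by rewrite K0_lift_freegB y0 z0 subr0.
- by rewrite !K0_lift_freegB !K0_lift_freegU f_dist // -addrA -opprD subrr.
Qed.

Lemma K0_lift_pi x : K0_lift_fun (quotient_map K0_relations x) = K0_lift_freeg x.
Proof.
apply/eqP; rewrite -subr_eq0 -K0_lift_freegB; apply/eqP/K0_lift_freeg_rel.
by have /quotient_map_eq/asboolP := quotient_mapK (quotient_map K0_relations x).
Qed.

Lemma K0_lift_is_additive : zmod_morphism K0_lift_fun.
Proof.
move=> x y; rewrite -[x]quotient_mapK -[y]quotient_mapK -raddfB.
by rewrite !K0_lift_pi K0_lift_freegB.
Qed.

Definition K0_lift : {additive K0 -> M} :=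
  HB.pack K0_lift_fun
    (GRing.isZmodMorphism.Build K0 M K0_lift_fun K0_lift_is_additive).

Lemma K0_liftE (A : T) : K0_lift (K0_class A) = f A.
Proof. by rewrite /= K0_lift_pi K0_lift_freegU. Qed.

End Lift.

Lemma K0_class_dist (t : triangle T) : dist t ->
  K0_class (t2 t) = K0_class (t1 t) + K0_class (t3 t).
Proof.
move=> dt; rewrite -raddfD; apply/quotient_map_eq; rewrite opprD addrA.
exact/asboolP/K0_relation_dist.
Qed.

End Grothendieck.

Section K0Map.
Variables (T U : tri_data) (F : exact_functor T U).

Lemma K0_map_dist (t : triangle T) : dist t ->
  K0_class (F (t2 t)) = K0_class (F (t1 t)) + K0_class (F (t3 t)).
Proof. by move=> /(@ef_dist _ _ F) /K0_class_dist. Qed.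

Definition K0_map : {additive K0 T -> K0 U} :=
  @K0_lift T (K0 U) (fun A => K0_class (F A)) K0_map_dist.

End K0Map.

Record symmetric_monoidal (C : category) := SymmetricMonoidal {
  tens : C -> C -> C;
  tensm : forall A A' B B' : C,
    hom A A' -> hom B B' -> hom (tens A B) (tens A' B');
  tensm1 : forall A B : C, tensm (idm A) (idm B) = idm (tens A B);
  tensmM : forall (A A' A'' B B' B'' : C) (f' : hom A' A'') (f : hom A A')
      (g' : hom B' B'') (g : hom B B'),
    tensm (f' ∘ f) (g' ∘ g) = tensm f' g' ∘ tensm f g;
  tunit : C;
  tassoc : forall A B D : C, hom (tens (tens A B) D) (tens A (tens B D));
  tlunit : forall A : C, hom (tens tunit A) A;
  trunit : forall A : C, hom (tens A tunit) A;
  tsym : forall A B : C, hom (tens A B) (tens B A);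
  tassoc_iso : forall A B D, is_iso (tassoc A B D);
  tlunit_iso : forall A, is_iso (tlunit A);
  trunit_iso : forall A, is_iso (trunit A);
  tsymK : forall A B, tsym B A ∘ tsym A B = idm (tens A B);
  tassoc_nat : forall (A A' B B' D D' : C)
      (f : hom A A') (g : hom B B') (h : hom D D'),
    tassoc A' B' D' ∘ tensm (tensm f g) h = tensm f (tensm g h) ∘ tassoc A B D;
  tlunit_nat : forall (A A' : C) (f : hom A A'),
    tlunit A' ∘ tensm (idm tunit) f = f ∘ tlunit A;
  trunit_nat : forall (A A' : C) (f : hom A A'),
    trunit A' ∘ tensm f (idm tunit) = f ∘ trunit A;
  tsym_nat : forall (A A' B B' : C) (f : hom A A') (g : hom B B'),
    tsym A' B' ∘ tensm f g = tensm g f ∘ tsym A B;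
  tpentagon : forall A B D E : C,
    tassoc A B (tens D E) ∘ tassoc (tens A B) D E =
    tensm (idm A) (tassoc B D E) ∘ tassoc A (tens B D) E
      ∘ tensm (tassoc A B D) (idm E);
  ttriangle : forall A B : C,
    tensm (idm A) (tlunit B) ∘ tassoc A tunit B = tensm (trunit A) (idm B);
  thexagon : forall A B D : C,
    tensm (idm B) (tsym A D) ∘ tassoc B A D ∘ tensm (tsym A B) (idm D) =
    tassoc B D A ∘ tsym A (tens B D) ∘ tassoc A B D }.

Definition tens_left (C : category) (M : symmetric_monoidal C) (A : C) : functor C C.
Proof.
exists (tens M A) (fun B B' g => tensm M (idm A) g).
- by move=> B; rewrite tensm1.
- by move=> B B' B'' g' g; rewrite -tensmM comp1m.
Defined.

Definition tens_right (C : category) (M : symmetric_monoidal C) (B : C) : functor C C.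
Proof.
exists (fun A => tens M A B) (fun A A' f => tensm M f (idm B)).
- by move=> A; rewrite tensm1.
- by move=> A A' A'' f' f; rewrite -tensmM comp1m.
Defined.

Definition is_exact (T U : triangulated) (F : functor T U) : Prop :=
  is_additive F /\ exists E : exact_functor T U, ef_functor E = F.

Record tensor_triangulated := TensorTriangulated {
  tt_category :> triangulated;
  tt_monoidal : symmetric_monoidal tt_category;
  tt_exact_left : forall A : tt_category, is_exact (tens_left tt_monoidal A);
  tt_exact_right : forall B : tt_category, is_exact (tens_right tt_monoidal B) }.

Notation "A ⊗ B" := (tens (tt_monoidal _) A B) (at level 40, left associativity).

Section Spectrum.
Variable K : tensor_triangulated.

Record prime_ideal := PrimeIdeal {
  prime_thick :> thick K;
  prime_proper : exists A : K, ~ prime_thick A;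
  prime_tens : forall A B : K, prime_thick B -> prime_thick (A ⊗ B);
  prime_or : forall A B : K, prime_thick (A ⊗ B) -> prime_thick A \/ prime_thick B }.

Definition supp (A : K) : set prime_ideal := [set P : prime_ideal | ~ P A]%classic.

Definition subprime (Q P : prime_ideal) : Prop := forall A : K, Q A -> P A.

Record dimension_function := DimensionFunction {
  dim :> prime_ideal -> \bar int;
  dim_le : forall Q P, subprime Q P -> (dim Q <= dim P)%E;
  dim_eq : forall Q P (n : int), subprime Q P ->
    dim Q = n%:E -> dim P = n%:E -> Q = P }.

Variable d : dimension_function.

(* The least upper bound in Z ∪ {±∞}, with value -∞ on the empty set. *)
Definition dim_set (V : set prime_ideal) : \bar int :=
  supremum -oo%E (d @` V)%classic.

Lemma ereal_int_supremums (A : set (\bar int)) :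
  (A !=set0)%classic -> (supremums A !=set0)%classic.
Proof.
move=> [x0 Ax0].
have [[n An]|unb] := pselect (exists n : int, forall x, A x -> (x <= n%:E)%E); last first.
  exists +oo%E; split=> [x _|y Ay]; first exact: leey.
  case: y Ay => [r| |] Ay //; exfalso; apply: unb.
    by exists r => x /Ay.
  by exists 0 => x /Ay; rewrite leeNy_eq => /eqP ->; apply: leNye.
have [[m0 Am0]|noint] := pselect (exists m : int, A m%:E); last first.
  exists -oo%E; split=> [x Ax|y _]; last exact: leNye.
  case: x Ax => [r| |] Ax //; first by exfalso; apply: noint; exists r.
  by have := An _ Ax.
have exk : exists k : nat, `[< A (n - k%:Z)%:E >].
  exists `|n - m0|%N; apply/asboolP.
  have := An _ Am0; rewrite lee_fin -subr_ge0 => le.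
  by rewrite gez0_abs // opprB addrC subrK.
case: (ex_minnP exk) => k /asboolP Ak mink.
exists (n - k%:Z)%:E; split=> [x Ax|y Ay]; last exact: Ay.
case: x Ax => [r| |] Ax; [|by have := An _ Ax|exact: leNye].
have := An _ Ax; rewrite !lee_fin -subr_ge0 => le.
have : `[< A (n - `|n - r|%N%:Z)%:E >].
  by apply/asboolP; rewrite gez0_abs // opprB addrC subrK.
by move=> /mink; rewrite -lez_nat gez0_abs // lerBrDr addrC -lerBrDr.
Qed.

Lemma dim_set_le (V : set prime_ideal) (p : int) :
  (dim_set V <= p%:E)%E <-> forall P, V P -> (d P <= p%:E)%E.
Proof.
split=> [le P VP|le].
  apply: le_trans le; apply: ge_supremum_Nmem; last by exists P.
  by apply: ereal_int_supremums; exists (d P), P.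
rewrite /dim_set /supremum; case: ifPn => [_|/set0P ne]; first exact: leNye.
have /ereal_int_supremums [s ss] := ne.
case: xgetP => [y _ [_]|/(_ s) //]; apply.
by move=> x [P VP <-]; apply: le.
Qed.

Variable p : int.

Definition dim_at_most (A : K) : Prop := (dim_set (supp A) <= p%:E)%E.

Lemma dim_at_mostP (A : K) :
  dim_at_most A <-> forall P : prime_ideal, ~ P A -> (d P <= p%:E)%E.
Proof. exact: dim_set_le. Qed.

Lemma dim_at_most_is_thick : is_thick dim_at_most.
Proof.
split.
- by move=> Z Z0; apply/dim_at_mostP => P; case; apply: (thick_zero (thickP P)).
- move=> A B iAB /dim_at_mostP JA; apply/dim_at_mostP => P PB; apply: JA => PA.
  exact/PB/(thick_iso (thickP P) iAB).
- move=> A; split=> /dim_at_mostP JA; apply/dim_at_mostP => P PA; apply: JA => PA'.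
  + exact: PA ((thick_shift (thickP P) A).1 PA').
  + exact: PA ((thick_shift (thickP P) A).2 PA').
- move=> t dt /dim_at_mostP J1 /dim_at_mostP J2; apply/dim_at_mostP => P P3.
  have [P1|] := pselect (P (t1 t)); last exact: J1.
  have [P2|] := pselect (P (t2 t)); last exact: J2.
  by case: P3; apply: (thick_cone (thickP P) dt).
- move=> A B C bi /dim_at_mostP JA /dim_at_mostP JB; apply/dim_at_mostP => P PC.
  have [PA|] := pselect (P A); last exact: JA.
  have [PB|] := pselect (P B); last exact: JB.
  by case: PC; apply: (thick_biproduct (thickP P) bi).
- move=> A B C bi /dim_at_mostP JC; apply/dim_at_mostP => P PA; apply: JC => PC.
  exact/PA/(thick_summand (thickP P) bi).
Qed.

Definition dim_thick : thick K := Thick dim_at_most_is_thick.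

Lemma dim_at_mostS (q : int) (A : K) : p <= q ->
  dim_at_most A -> (dim_set (supp A) <= q%:E)%E.
Proof. by move=> pq /le_trans; apply; rewrite lee_fin. Qed.

End Spectrum.

Section Chow.
Variables (K : tensor_triangulated) (d : dimension_function K) (p : int).

Definition filt (q : int) : triangulated := full_subcategory (dim_thick d q).

Definition filt_quot : tri_data :=
  verdier (thick_within (dim_thick d p) (dim_thick d (p - 1))).

Definition filt_proj : exact_functor (filt p) filt_quot := verdier_quotient _.

Lemma filt_le (A : K) : dim_thick d p A -> dim_thick d (p + 1) A.
Proof. by apply: dim_at_mostS; rewrite lerDl. Qed.

Definition filt_incl : exact_functor (filt p) (filt (p + 1)) :=
  @restrict K K (id_exact K) _ _ filt_le.

Definition cycle_group : zmodType := K0 (karoubi filt_quot).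

Definition chow_i : {additive K0 (filt p) -> K0 (filt (p + 1))} := K0_map filt_incl.
Definition chow_q : {additive K0 (filt p) -> K0 filt_quot} := K0_map filt_proj.
Definition chow_j : {additive K0 filt_quot -> cycle_group} :=
  K0_map (karoubi_embedding filt_quot).

Definition chow_relations : {pred cycle_group} := fun z =>
  `[< exists x, chow_i x = 0 /\ chow_j (chow_q x) = z >].

Lemma chow_relations_closed : zmod_closed chow_relations.
Proof.
split=> [|y z /asboolP [x [x0 <-]] /asboolP [x' [x'0 <-]]]; apply/asboolP.
  by exists 0; rewrite !raddf0.
by exists (x - x'); rewrite !raddfB x0 x'0 subr0.
Qed.

HB.instance Definition _ :=
  GRing.isZmodClosed.Build cycle_group chow_relations chow_relations_closed.

Definition chow_group : zmodType := quotient_group chow_relations.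

Definition chow_proj : {additive cycle_group -> chow_group} :=
  quotient_map chow_relations.

End Chow.

Section RelativeDimension.
Variables (K L : tensor_triangulated).
Variables (dK : dimension_function K) (dL : dimension_function L).
Variable F : exact_functor K L.

Definition maps_filtration (n : int) : Prop :=
  forall (p : int) (A : K), dim_thick dK p A -> dim_thick dL (p + n) (F A).

Definition has_relative_dimension (n : int) : Prop :=
  maps_filtration n /\ forall m : int, maps_filtration m -> n <= m.

Definition relative_dimension_le (n : int) : Prop :=
  exists2 m : int, has_relative_dimension m & m <= n.

Definition relative_dimension_lt (n : int) : Prop :=
  exists2 m : int, has_relative_dimension m & m < n.

Variables n p : int.

(* [G] is the functor between the subquotients that [F] gives: the square
   formed by [G], the restriction of [F] and the quotient functors commutes up
   to an isomorphism compatible with the shifts. *)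
Definition induced_on_quotients
    (G : exact_functor (filt_quot dK p) (filt_quot dL (p + n))) : Prop :=
  exists FKL : (forall A : K, dim_thick dK p A -> dim_thick dL (p + n) (F A)),
    exact_iso (comp_exact G (filt_proj dK p))
      (comp_exact (filt_proj dL (p + n)) (restrict FKL)).

(* The functor between the subquotients is determined only up to isomorphism;
   the second clause makes [z] independent of its choice. *)
Definition induced_on_cycles
    (z : {additive cycle_group dK p -> cycle_group dL (p + n)}) : Prop :=
  (exists G, induced_on_quotients G) /\
  (forall G, induced_on_quotients G -> z =1 K0_map (karoubi_map G)).

Definition induced_on_chow
    (z : {additive cycle_group dK p -> cycle_group dL (p + n)})
    (c : {additive chow_group dK p -> chow_group dL (p + n)}) : Prop :=
  forall x, c (chow_proj dK p x) = chow_proj dL (p + n) (z x).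

End RelativeDimension.

(* Main.v *)
From HB Require Import structures.
From mathcomp Require Import all_boot all_order all_algebra.
From mathcomp Require Import boolp.
From mathcomp.multinomials Require Import freeg.
Require Import Defs.

Set Implicit Arguments.
Unset Strict Implicit.
Unset Printing Implicit Defensive.

(** Since F maps K_(p) into L_(p+n) and K_(p-1) into L_(p+n-1), it sends
    morphisms with cone in K_(p-1) to morphisms with cone in L_(p+n-1), so the
    universal property of localization gives an exact functor between the
    Verdier quotients (verdier_map), and K_0 of its idempotent completion is
    the map z on cycle groups.

    Independence of the choice of the induced functor G.  A natural isomorphism
    between two functors on T, both factored through a localization of T, is
    automatically natural on the localization (localization_nat).  Hence G is
    isomorphic to verdier_map, the two completed functors send each object to
    isomorphic objects (karoubi_map_isomorphic), and isomorphic objects have the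
    same class (karoubi_K0_iso).  The last point is not formal here, because
    the quotients and their completions carry only a class of triangles and no
    triangulated structure: for an isomorphism f : A -> B of retracts of X, the
    triangle A -> B -> 0 has to be exhibited as a direct factor of the image of
    X -> X -> 0 (karoubi_dist_iso).

    Chow groups.  The functor F commutes with the inclusions, the quotient
    functors and the embeddings into the completions.  So if x in K_0(K_(p))
    dies in K_0(K_(p+1)), then its pushforward dies in K_0(L_(p+n+1)), and z
    sends j(q(x)) to j(q(F x)), a relation of the target Chow group
    (cycle_map_relations).

    Vanishing.  If the relative dimension is less than n, then F sends K_(p)
    into L_(p+n-1), so every object of K_(p) becomes zero in the target quotient
    (verdier_thick_zero); all classes are then sent to 0, and the map on Chow
    groups is zero because the cycle group surjects onto its quotient. *)

Import Order.TTheory GRing.Theory Num.Theory.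
Local Open Scope ring_scope.

(** * Localizations *)

(** Naturality passes to composites, and naturality along an invertible morphism
    gives naturality along its inverse; all morphisms of a localization are
    words in images of morphisms and their inverses. *)
Lemma localization_nat (C D : category) (S : forall A B : C, hom A B -> Prop)
    (H1 H2 : functor (localization S) D) (eta : forall A : C, hom (H1 A) (H2 A)) :
  (forall (A B : C) (f : hom A B),
     eta B ∘ fmap H1 (fmap (loc_functor S) f) =
     fmap H2 (fmap (loc_functor S) f) ∘ eta A) ->
  forall (A B : localization S) (f : hom A B),
    eta B ∘ fmap H1 f = fmap H2 f ∘ eta A.
Proof.
move=> nat A B f; rewrite -[f]loc_clK.
elim: {f}(repr f) => {A B} [A B f|A B s Ss|A B E y IHy x IHx].
- exact: nat.
- pose ls : hom (A : localization S) B := loc_cl (w_of S s).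
  pose li : hom (B : localization S) A := loc_cl (w_inv Ss).
  have lisK : li ∘ ls = idm _.
    by rewrite /= loc_compE; apply/loc_clP/weq_invl.
  have lsiK : ls ∘ li = idm _.
    by rewrite /= loc_compE; apply/loc_clP/weq_invr.
  rewrite -[LHS]comp1m -fmap1 -lisK fmapM -!compA; congr (_ ∘ _).
  by rewrite compA -nat -compA -fmapM lsiK fmap1 compm1.
- pose ly : hom (B : localization S) E := loc_cl y.
  pose lx : hom (A : localization S) B := loc_cl x.
  have -> : loc_cl (w_comp y x) = ly ∘ lx by rewrite /= loc_compE.
  by rewrite !fmapM compA IHy -compA IHx compA.
Qed.

Definition const_functor (C D : category) (Z : D) : functor C D :=
  @Functor C D (fun=> Z) (fun _ _ _ => idm Z) (fun=> erefl)
    (fun _ _ _ _ _ => esym (comp1m (idm Z))).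

(** The maps 0 -> A are natural in A, so they form a transformation from the
    constant functor to the identity of the localization; naturality along
    f : 0 -> A forces f to be the localized one.  Dually for A -> 0. *)
Lemma localization_zero (C : category) (S : forall A B : C, hom A B -> Prop) (Z : C) :
  is_zero Z -> is_zero (Z : localization S).
Proof.
move=> Z0.
have inE (A : C) : {f : hom Z A | forall g : hom Z A, g = f}.
  have /cid[f [_ uf]] := (Z0 A).1.
  by exists f => g; rewrite -(uf g).
have outE (A : C) : {f : hom A Z | forall g : hom A Z, g = f}.
  have /cid[f [_ uf]] := (Z0 A).2.
  by exists f => g; rewrite -(uf g).
pose i A : hom (Z : localization S) A := fmap (loc_functor S) (sval (inE A)).
pose o A : hom (A : localization S) Z := fmap (loc_functor S) (sval (outE A)).
have idZ (f : hom Z Z) : f = idm Z.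
  by rewrite (svalP (inE Z) f) -(svalP (inE Z) (idm Z)).
have iZ : i Z = idm _ by rewrite /i (idZ (sval (inE Z))) fmap1.
have oZ : o Z = idm _ by rewrite /o (idZ (sval (outE Z))) fmap1.
move=> A; split.
- exists (i A); split=> // f _.
  have e := @localization_nat C _ S (const_functor _ (Z : localization S))
    (id_functor _) i _ Z A f.
  rewrite -[f](compm1) -iZ -[LHS]compm1; apply: e => X Y g.
  rewrite [LHS]compm1 /i -[RHS](fmapM (loc_functor S)).
  by rewrite (svalP (inE Y) (g ∘ _)).
- exists (o A); split=> // f _.
  have e := @localization_nat C _ S (id_functor _)
    (const_functor _ (Z : localization S)) o _ A Z f.
  rewrite -[f](comp1m) -oZ -[LHS]comp1m; apply: esym; apply: e => X Y g.
  rewrite [RHS]comp1m /o -[LHS](fmapM (loc_functor S)).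
  by rewrite (svalP (outE X) (_ ∘ g)).
Qed.

Lemma isomorphic_zero (C : category) (Z X : C) :
  is_zero Z -> isomorphic Z X -> is_zero X.
Proof.
move=> Z0 [f [g [gf fg]]] A; have [[u [_ uu]] [v [_ uv]]] := Z0 A; split.
- exists (u ∘ g); split=> // h _.
  by rewrite (uu (h ∘ f)) // -compA fg compm1.
- exists (f ∘ v); split=> // h _.
  by rewrite (uv (g ∘ h)) // compA fg comp1m.
Qed.

(** * Exact functors between Verdier quotients *)

Lemma verdier_shiftE (T : triangulated) (J : thick T) (A B : T) (f : hom A B) :
  fmap Σ (fmap (verdier_functor J) f) = fmap (verdier_functor J) (fmap Σ f).
Proof. exact: (loc_mapE (@verdier_inverted_shift T J) (w_of _ f)). Qed.

Section VerdierMap.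
Variables (T U : triangulated) (J : thick T) (I : thick U) (F : exact_functor T U).
Hypothesis FJI : forall A : T, J A -> I (F A).

Lemma verdier_inverted_map (A B : T) (f : hom A B) :
  verdier_inverted J f -> verdier_inverted I (fmap F f).
Proof.
move=> [C [g [h [d JC]]]]; exists (F C), (fmap F g), (ef_shift F A ∘ fmap F h).
by split; [apply: (@ef_dist _ _ F _ d)|apply: FJI].
Qed.

Definition verdier_map_functor : functor (verdier J) (verdier I) :=
  loc_map verdier_inverted_map.

Definition verdier_map_shift (A : verdier J) :
    hom (verdier_map_functor (Σ A)) (Σ (verdier_map_functor A)) :=
  fmap (verdier_functor I) (ef_shift F A).

Lemma verdier_mapE (A B : T) (f : hom A B) :
  fmap verdier_map_functor (fmap (verdier_functor J) f) =
  fmap (verdier_functor I) (fmap F f).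
Proof. exact: (loc_mapE verdier_inverted_map (w_of _ f)). Qed.

Lemma verdier_map_shift_nat (A B : verdier J) (f : hom A B) :
  verdier_map_shift B ∘ fmap verdier_map_functor (fmap Σ f) =
  fmap Σ (fmap verdier_map_functor f) ∘ verdier_map_shift A.
Proof.
apply: (@localization_nat T (verdier I) (@verdier_inverted T J)
  (comp_functor verdier_map_functor (@shift (verdier J)))
  (comp_functor (@shift (verdier I)) verdier_map_functor) verdier_map_shift).
move=> {A B f} A B f.
have e1 : fmap verdier_map_functor (fmap Σ (fmap (verdier_functor J) f)) =
          fmap (verdier_functor I) (fmap F (fmap Σ f)).
  by rewrite verdier_shiftE; apply: verdier_mapE.
have e2 : fmap Σ (fmap verdier_map_functor (fmap (verdier_functor J) f)) =
          fmap (verdier_functor I) (fmap Σ (fmap F f)).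
  by rewrite verdier_mapE; apply: verdier_shiftE.
apply: (etrans (congr1 (fun x => verdier_map_shift B ∘ x) e1)).
apply: (etrans _ (esym (congr1 (fun x => x ∘ verdier_map_shift A) e2))).
rewrite -[LHS](fmapM (verdier_functor I)) -[RHS](fmapM (verdier_functor I)).
by rewrite ef_shift_nat.
Qed.

Lemma verdier_map_dist (u : triangle (verdier J)) :
  dist u -> @dist (verdier I) (map_triangle verdier_map_shift u).
Proof.
case=> t [dt [m [i1 i2 i3]]].
exists (map_triangle (ef_shift F) t); split; first exact: ef_dist.
pose GFt := verdier_image I (map_triangle (ef_shift F) t).
have ef : tf GFt = fmap verdier_map_functor (tf (verdier_image J t)).
  by apply: esym; apply: verdier_mapE.
have eg : tg GFt = fmap verdier_map_functor (tg (verdier_image J t)).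
  by apply: esym; apply: verdier_mapE.
have eh : th GFt = verdier_map_shift (t1 t) ∘
                   fmap verdier_map_functor (th (verdier_image J t)).
  have e : fmap verdier_map_functor (th (verdier_image J t)) =
           fmap (verdier_functor I) (fmap F (th t)).
    by apply: etrans (verdier_mapE (th t)); rewrite [th _]comp1m.
  rewrite e [LHS]comp1m; exact: (fmapM (verdier_functor I)).
unshelve eexists.
  exists (fmap verdier_map_functor (m1 m)) (fmap verdier_map_functor (m2 m))
         (fmap verdier_map_functor (m3 m)).
  - rewrite -/GFt ef -[LHS](fmapM verdier_map_functor) (m_f m).
    exact: (fmapM verdier_map_functor).
  - rewrite -/GFt eg -[LHS](fmapM verdier_map_functor) (m_g m).
    exact: (fmapM verdier_map_functor).
  - rewrite -/GFt eh compA -[X in X ∘ _](verdier_map_shift_nat (m1 m)) -compA.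
    rewrite -[X in _ ∘ X](fmapM verdier_map_functor) (m_h m).
    rewrite [X in _ ∘ X](fmapM verdier_map_functor).
    exact: compA.
by split; apply: is_iso_fmap.
Qed.

Definition verdier_map : exact_functor (verdier J) (verdier I).
Proof.
refine (@ExactFunctor _ _ verdier_map_functor verdier_map_shift _ _ _).
- move=> A; apply: (@is_iso_fmap _ _ (verdier_functor I)); exact: ef_shift_iso.
- exact: verdier_map_shift_nat.
- exact: verdier_map_dist.
Defined.

Lemma verdier_map_square :
  exact_iso (comp_exact verdier_map (verdier_quotient J))
            (comp_exact (verdier_quotient I) F).
Proof.
exists (fun A => idm (F A : verdier I)); split.
- by move=> A; apply: is_iso_idm.
- by move=> A B f; rewrite comp1m compm1; apply: verdier_mapE.
- move=> A; rewrite fmap1 comp1m compm1 [RHS]comp1m.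
  apply: etrans (compm1 _); congr (_ ∘ _); exact: (fmap1 verdier_map_functor).
Qed.

End VerdierMap.

Lemma verdier_zero (T : triangulated) (J : thick T) (Z : T) :
  is_zero Z -> is_zero (Z : verdier J).
Proof. exact: localization_zero. Qed.

(** Both 0 and X lie in J, hence so does the cone of 0 -> X, and this map is
    inverted in the quotient. *)
Lemma verdier_thick_zero (T : triangulated) (J : thick T) (X : T) :
  J X -> is_zero (X : verdier J).
Proof.
move=> JX; have ax := tr_axioms T; have [Z Z0] := tr_zero ax.
apply: (@isomorphic_zero (verdier J) Z); first exact: verdier_zero.
have inv0 : verdier_inverted J (0 : hom Z X).
  have [C [g [h d]]] := tr_cone ax (0 : hom Z X).
  exists C, g, h; split=> //.
  by apply: (thick_cone (thickP J) d) => //=; apply: (thick_zero (thickP J)).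
exists (loc_cl (w_of _ (0 : hom Z X))), (loc_cl (w_inv inv0)); split.
- by rewrite /= loc_compE; apply/loc_clP/weq_invl.
- by rewrite /= loc_compE; apply/loc_clP/weq_invr.
Qed.

Lemma verdier_id_dist (T : triangulated) (J : thick T) (X : verdier J) :
  exists (Z : verdier J) (g : hom X Z) (h : hom Z (Σ X)),
    is_zero Z /\ dist (Triangle (idm X) g h).
Proof.
have ax := tr_axioms T; have [Z Z0] := tr_zero ax.
pose t := Triangle (idm (X : T)) (0 : hom _ Z) 0.
have dt : dist t by apply: (tr_id ax).
exists Z, (tg (verdier_image J t)), (th (verdier_image J t)).
split; first exact: verdier_zero.
exact: (@ef_dist _ _ (verdier_quotient J) t dt).
Qed.

(** * Grothendieck groups of idempotent completions *)

(** The Grothendieck group is generated by classes. *)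
Lemma K0_ext (T : tri_data) (M : zmodType) (f g : {additive K0 T -> M}) :
  (forall A, f (K0_class A) = g (K0_class A)) -> f =1 g.
Proof.
move=> fg x; rewrite -[x]quotient_mapK.
set y := repr _; rewrite -[y]freeg_sumE !raddf_sum; apply: eq_bigr => A _.
rewrite -[coeff A y]intz -freegU_mulz !raddfMz.
by congr (_ *~ _); apply: fg.
Qed.

Lemma K0_mapE (T U : tri_data) (F : exact_functor T U) (A : T) :
  K0_map F (K0_class A) = K0_class (F A).
Proof. exact: K0_liftE. Qed.

Lemma zero_homl (C : category) (Z A : C) (f g : hom Z A) : is_zero Z -> f = g.
Proof. by move=> /(_ A)[[h [_ uh]] _]; rewrite -(uh f) // (uh g). Qed.

Lemma zero_homr (C : category) (Z A : C) (f g : hom A Z) : is_zero Z -> f = g.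
Proof. by move=> /(_ A)[_ [h [_ uh]]]; rewrite -(uh f) // (uh g). Qed.

Lemma karoubi_zero (T : tri_data) (A : karoubi T) :
  is_zero (k_obj A) -> is_zero A.
Proof.
move=> A0 B; have [[f [_ uf]] [g [_ ug]]] := A0 (k_obj B); split.
- unshelve eexists; first by exists f; split; apply: zero_homl A0.
  by split=> // h _; apply: karoubi_hom_eq; apply: zero_homl A0.
- unshelve eexists; first by exists g; split; apply: zero_homr A0.
  by split=> // h _; apply: karoubi_hom_eq; apply: zero_homr A0.
Qed.

Section KaroubiK0.
Variable T : tri_data.
Hypothesis id_dist : forall X : T, exists (Z : T) (g : hom X Z) (h : hom Z (Σ X)),
  is_zero Z /\ dist (Triangle (idm X) g h).

(** Both A and B are retracts of the object X underlying A: A through its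
    idempotent, B through A and the isomorphism f.  These retractions turn
    A -> B -> Z into a direct factor of X -> X -> 0, the remaining squares
    commuting because a corner of each of them is zero. *)
Lemma karoubi_dist_iso (A B Z : karoubi T) (f : hom A B) (g : hom B Z)
    (h : hom Z (Σ A)) :
  is_iso f -> is_zero Z -> dist (Triangle f g h).
Proof.
move=> [f' [f'f ff']] Z0.
have [Z' [g' [h' [Z'0 dt]]]] := id_dist (k_obj A).
pose t := Triangle (idm (k_obj A)) g' h'.
have eZ0 : is_zero (t3 (karoubi_image t)) by apply: karoubi_zero.
have [[s3 _] [r3 _]] := Z0 (t3 (karoubi_image t)).
exists t; split=> //.
pose s1 : hom A (karoubi_functor T (k_obj A)) :=
  exist _ (k_idem A) (conj (k_idemK A) (comp1m _)).
pose r1 : hom (karoubi_functor T (k_obj A)) A :=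
  exist _ (k_idem A) (conj (compm1 _) (k_idemK A)).
have rs1 : r1 ∘ s1 = idm A by apply: karoubi_hom_eq; apply: k_idemK.
have id1 : tf (karoubi_image t) = idm _ by apply: karoubi_hom_eq.
unshelve eexists.
  apply: (@TriangleMor _ (Triangle f g h) (karoubi_image t) s1 (s1 ∘ f') s3).
  - rewrite id1 comp1m; apply: etrans (esym (compA s1 f' f)) _.
    by rewrite f'f compm1.
  - exact: zero_homr.
  - exact: zero_homl.
unshelve eexists.
  apply: (@TriangleMor _ (karoubi_image t) (Triangle f g h) r1 (f ∘ r1) r3).
  - by rewrite id1 compm1.
  - exact: zero_homr.
  - exact: zero_homl.
split; [exact: rs1| |exact: (zero_homr _ _ Z0)].
apply: etrans (esym (compA f r1 _)) _.
by rewrite (compA r1 s1 f') rs1 comp1m.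
Qed.

(** The triangle Z -> Z -> Z is distinguished, so the class of Z is its own
    double. *)
Lemma karoubi_K0_zero (Z : karoubi T) : is_zero Z -> K0_class Z = 0.
Proof.
move=> Z0; have [_ [h _]] := Z0 (Z : karoubi T); have [[k _] _] := Z0 (Σ Z).
have d := karoubi_dist_iso (idm Z) k (is_iso_idm Z) Z0.
have /= e := K0_class_dist d.
by apply: (addrI (K0_class Z)); rewrite addr0 -e.
Qed.

Lemma karoubi_K0_iso (A B : karoubi T) : isomorphic A B -> K0_class A = K0_class B.
Proof.
move=> [f iso_f].
have [Z' [_ [_ [Z'0 _]]]] := id_dist (k_obj A).
have Z0 : is_zero (karoubi_functor T Z') by apply: karoubi_zero.
have [_ [g _]] := Z0 B; have [[h _] _] := Z0 (Σ A).
have /= := K0_class_dist (karoubi_dist_iso g h iso_f Z0).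
by rewrite (karoubi_K0_zero Z0) addr0 => ->.
Qed.

End KaroubiK0.

(** The component at the retract (X, e) is eta cut down by e; naturality makes
    it commute with the idempotents. *)
Lemma karoubi_map_isomorphic (T U : tri_data) (F G : exact_functor T U)
    (eta : forall A : T, hom (F A) (G A)) :
  (forall A, is_iso (eta A)) ->
  (forall (A B : T) (f : hom A B), eta B ∘ fmap F f = fmap G f ∘ eta A) ->
  forall A, isomorphic (karoubi_map F A) (karoubi_map G A).
Proof.
move=> eta_iso nat A; have [theta [te et]] := eta_iso (k_obj A).
have nat' : theta ∘ fmap G (k_idem A) = fmap F (k_idem A) ∘ theta.
  rewrite -[LHS]compm1 -et -!compA (compA _ (eta _)) -nat.
  by rewrite !compA te comp1m.
unshelve eexists.
  exists (eta (k_obj A) ∘ fmap F (k_idem A)); split=> /=.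
  - by rewrite -compA -fmapM k_idemK.
  - by rewrite nat compA -fmapM k_idemK.
unshelve eexists.
  exists (theta ∘ fmap G (k_idem A)); split=> /=.
  - by rewrite -compA -fmapM k_idemK.
  - by rewrite nat' compA -fmapM k_idemK.
split; apply: karoubi_hom_eq => /=.
- by rewrite nat' -compA (compA theta) te comp1m -fmapM k_idemK.
- by rewrite nat -compA (compA _ theta) et comp1m -fmapM k_idemK.
Qed.

(** Only a propositional equality: the idempotents are F (id) and id. *)
Lemma karoubi_map_embedding (T U : tri_data) (F : exact_functor T U) (A : T) :
  karoubi_map F (karoubi_embedding T A) = karoubi_embedding U (F A).
Proof.
have objE (B : U) (e e' : hom B B) (eK : e ∘ e = e) (e'K : e' ∘ e' = e') :
    e = e' -> KaroubiObj eK = KaroubiObj e'K.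
  by move=> ee'; subst e'; congr KaroubiObj; apply: Prop_irrelevance.
by apply: objE; apply: fmap1.
Qed.

Lemma quotient_map_factor (G M : zmodType) (H : zmodClosed G) (f : {additive G -> M}) :
  (forall x, x \in H -> f x = 0) ->
  exists c : {additive quotient_group H -> M}, forall x, c (quotient_map H x) = f x.
Proof.
move=> fH; pose c0 (x : quotient_group H) : M := f (repr (x : Quotient.quot H)).
have c0E x : c0 (quotient_map H x) = f x.
  apply/eqP; rewrite -subr_eq0 -raddfB; apply/eqP/fH/quotient_map_eq.
  exact: quotient_mapK.
have c0B : zmod_morphism c0.
  move=> x y; rewrite -[x]quotient_mapK -[y]quotient_mapK -raddfB.
  by rewrite !c0E raddfB.
pose c : {additive quotient_group H -> M} :=
  HB.pack c0 (GRing.isZmodMorphism.Build (quotient_group H) M c0 c0B).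
by exists c.
Qed.

(** * The homomorphisms on cycle and Chow groups *)

(** The isomorphism between the restrictions along T -> T/J is natural on all
    of T/J, so it induces one between the completed functors. *)
Lemma verdier_map_K0_unique (T U : triangulated) (J : thick T) (I : thick U)
    (F : exact_functor T U) (FJI : forall A : T, J A -> I (F A))
    (G : exact_functor (verdier J) (verdier I)) :
  exact_iso (comp_exact G (verdier_quotient J)) (comp_exact (verdier_quotient I) F) ->
  K0_map (karoubi_map (verdier_map FJI)) =1 K0_map (karoubi_map G).
Proof.
move=> [eta [eta_iso eta_nat _]]; apply: K0_ext => A; rewrite !K0_liftE.
apply: esym; apply: (karoubi_K0_iso (@verdier_id_dist U I)).
apply: (@karoubi_map_isomorphic _ _ G (verdier_map FJI) eta eta_iso).
apply: localization_nat => X Y f.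
by rewrite [fmap (verdier_map FJI) _]verdier_mapE; apply: eta_nat.
Qed.

Section Pushforward.
Variables (K L : tensor_triangulated).
Variables (dK : dimension_function K) (dL : dimension_function L).
Variables (F : exact_functor K L) (n : int).
Hypothesis F_filt : maps_filtration dK dL F n.

Definition filt_map (p : int) : exact_functor (filt dK p) (filt dL (p + n)) :=
  restrict (F_filt (p := p)).

Lemma filt_map_sub (p : int) (A : filt dK p) :
  thick_within (dim_thick dK p) (dim_thick dK (p - 1)) A ->
  thick_within (dim_thick dL (p + n)) (dim_thick dL (p + n - 1)) (filt_map p A).
Proof. by move=> /F_filt; rewrite addrAC. Qed.

Definition quot_map (p : int) :
  exact_functor (filt_quot dK p) (filt_quot dL (p + n)) :=
  verdier_map (@filt_map_sub p).

Definition cycle_map (p : int) :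
  {additive cycle_group dK p -> cycle_group dL (p + n)} :=
  K0_map (karoubi_map (quot_map p)).

Lemma cycle_map_induced (p : int) : induced_on_cycles F (cycle_map p).
Proof.
split.
  by exists (quot_map p), (F_filt (p := p)); apply: verdier_map_square.
move=> G [FKL]; rewrite (Prop_irrelevance FKL (F_filt (p := p))).
exact: verdier_map_K0_unique.
Qed.

Lemma cycle_map_proj (p : int) (x : K0 (filt dK p)) :
  cycle_map p (chow_j dK p (chow_q dK p x)) =
  chow_j dL (p + n) (chow_q dL (p + n) (K0_map (filt_map p) x)).
Proof.
apply: (@K0_ext _ _ (cycle_map p \o (chow_j dK p \o chow_q dK p))
  (chow_j dL (p + n) \o (chow_q dL (p + n) \o K0_map (filt_map p)))) => A.
rewrite -[LHS]/(cycle_map p (chow_j _ _ (chow_q _ _ (K0_class A)))).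
rewrite -[RHS]/(chow_j _ _ (chow_q _ _ (K0_map (filt_map p) (K0_class A)))).
rewrite /chow_j /chow_q /cycle_map !K0_mapE.
by rewrite karoubi_map_embedding.
Qed.

(** F also restricts to K_(p+1) -> L_(p+n+1), compatibly with the inclusions. *)
Lemma filt_map_incl (p : int) (x : K0 (filt dK p)) :
  chow_i dK p x = 0 -> chow_i dL (p + n) (K0_map (filt_map p) x) = 0.
Proof.
have F1 (A : K) : dim_thick dK (p + 1) A -> dim_thick dL (p + n + 1) (F A).
  by rewrite addrAC; apply: F_filt.
move=> x0; rewrite -[RHS](raddf0 (K0_map (restrict F1))) -x0.
apply: (@K0_ext _ _ (chow_i dL (p + n) \o K0_map (filt_map p))
  (K0_map (restrict F1) \o chow_i dK p)) => A.
rewrite -[LHS]/(chow_i _ _ (K0_map (filt_map p) (K0_class A))).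
rewrite -[RHS]/(K0_map (restrict F1) (chow_i _ _ (K0_class A))).
rewrite /chow_i !K0_mapE; congr K0_class.
exact: eq_exist.
Qed.

Lemma cycle_map_relations (p : int) (z : cycle_group dK p) :
  z \in chow_relations (d := dK) (p := p) ->
  cycle_map p z \in chow_relations (d := dL) (p := p + n).
Proof.
move=> /asboolP[x [x0 <-]]; apply/asboolP; exists (K0_map (filt_map p) x).
by split; [apply: filt_map_incl|rewrite cycle_map_proj].
Qed.

Lemma chow_map_exists (p : int) :
  exists c : {additive chow_group dK p -> chow_group dL (p + n)},
    induced_on_chow (cycle_map p) c.
Proof.
apply: (quotient_map_factor (f := chow_proj dL (p + n) \o cycle_map p)) => x xR.
rewrite /= -[RHS](raddf0 (chow_proj dL (p + n))).
by apply/quotient_map_eq; rewrite subr0; apply: cycle_map_relations.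
Qed.

(** Every object of K_(p) is sent into the subcategory L_(p+n-1) that the target
    quotient kills. *)
Lemma cycle_map_eq0 (p : int) :
  maps_filtration dK dL F (n - 1) -> forall x, cycle_map p x = 0.
Proof.
move=> F_filt1; apply: (@K0_ext _ _ (cycle_map p) \0) => A.
rewrite /cycle_map K0_mapE.
apply: (karoubi_K0_zero (@verdier_id_dist _ _)); apply: karoubi_zero.
apply: verdier_thick_zero.
by rewrite /= -addrA; apply: F_filt1; apply: (svalP (k_obj A)).
Qed.

End Pushforward.

Lemma maps_filtrationS (K L : tensor_triangulated)
    (dK : dimension_function K) (dL : dimension_function L)
    (F : exact_functor K L) (m n : int) :
  m <= n -> maps_filtration dK dL F m -> maps_filtration dK dL F n.
Proof. by move=> mn Fm q A /Fm; apply: dim_at_mostS; rewrite lerD2l. Qed.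

Theorem theorem4p1p3 (K L : tensor_triangulated)
    (dK : dimension_function K) (dL : dimension_function L) (n : int)
    (F : exact_functor K L) (F_additive : is_additive F)
    (F_dim : relative_dimension_le dK dL F n) (p : int) :
  exists (z : {additive cycle_group dK p -> cycle_group dL (p + n)})
         (c : {additive chow_group dK p -> chow_group dL (p + n)}),
  [/\ induced_on_cycles F z,
      induced_on_chow z c &
      relative_dimension_lt dK dL F n ->
        (forall x, z x = 0) /\ (forall x, c x = 0)].
Proof.
have [m [Fm _] /maps_filtrationS/(_ Fm) Fn] := F_dim.
have [c cP] := chow_map_exists Fn p.
exists (cycle_map Fn p), c; split=> //; first exact: cycle_map_induced.
move=> [m' [Fm' _] m'n].
have z0 : forall x, cycle_map Fn p x = 0.
  apply: cycle_map_eq0; apply: maps_filtrationS Fm'.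
  by rewrite lerBrDr lezD1.
split=> // x; rewrite -[x]quotient_mapK [LHS]cP.
by rewrite z0 raddf0.
Qed.
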